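(* Let $V(\Gamma^\dag)$ be a Hilbert space and $V^*(\Gamma^\dag)$ a unitary realisation of its dual space, with dual pairing $\langle\cdot,\cdot\rangle$. Let $V(\Gamma)$, $V(\Gamma_j)$, $V_h(\Gamma_j)$, $j\in\mathbb{N}_0$, be closed subspaces of $V(\Gamma^\dag)$ with $V_h(\Gamma_j)\subset V(\Gamma_j)$ for all $j\in\mathbb{N}_0$. Suppose that (i) $A:V(\Gamma^\dag)\to V^*(\Gamma^\dag)$ is compactly perturbed coercive; (ii) $A$ is invertible on $V(\Gamma)$; (iii) $V(\Gamma_j)\xrightarrow{M}V(\Gamma)$ as $j\to\infty$ (Mosco convergence); (iv) there exists a dense subspace $\widetilde W\subset V(\Gamma)$ such that, for all $w\in\widetilde W$, $\inf_{v_h\in V_h(\Gamma_j)}\|w-v_h\|_{V(\Gamma^\dag)}\to0$ as $j\to\infty$. Then there exists $J\in\mathbb{N}$ such that for each $j\ge J$ and $f\in V^*(\Gamma^\dag)$ the problem: find $u_j^h\in V_h(\Gamma_j)$ such that $$\langle Au_j^h,v_j^h\rangle=\langle f,v_j^h\rangle\quad\text{for all }v_j^h\in V_h(\Gamma_j),$$ is well-posed, and $\|u_j^h-u\|_{V(\Gamma^\dag)}\to0$ as $j\to\infty$, where $u$ is the unique element of $V(\Gamma)$ satisfying $$\langle Au,v\rangle=\langle f,v\rangle\quad\text{for all }v\in V(\Gamma).$$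
   Context: The symbols $\Gamma^\dag,\Gamma,\Gamma_j$ and $h$ are here only labels for abstract spaces. A Hilbert space $\mathcal{H}$ is a unitary realisation of $H^*$ with dual pairing $\langle\cdot,\cdot\rangle:\mathcal{H}\times H\to\mathbb{C}$ if $u\mapsto\langle u,\cdot\rangle$ is a unitary isomorphism from $\mathcal{H}$ to $H^*$. A bounded linear operator $A:H\to\mathcal{H}$ is coercive if there is $\alpha>0$ with $|\langle Au,u\rangle|\ge\alpha\|u\|_H^2$ for all $u\in H$; it is compactly perturbed coercive if $A=A_0+A_1$ with $A_0$ coercive and $A_1$ compact. For a closed subspace $W\subset H$, let $\mathcal{W}:=(W^{a,\mathcal{H}})^\perp\subset\mathcal{H}$, where $W^{a,\mathcal{H}}=\{f\in\mathcal{H}:\langle f,w\rangle=0\ \forall w\in W\}$; $A$ is invertible on $W$ if $P_{\mathcal{W}}A|_W:W\to\mathcal{W}$ is invertible, where $P_{\mathcal{W}}$ is orthogonal projection onto $\mathcal{W}$; equivalently, for every $f\in\mathcal{W}$ there is a unique $u_W\in W$ with $\langle Au_W,v\rangle=\langle f,v\rangle$ for all $v\in W$. Mosco convergence: for closed subspaces $W,W_j$ ($j\in\mathbb{N}$) of a Hilbert space $H$, $W_j\xrightarrow{M}W$ means (a) for every $w\in W$ there exist $w_j\in W_j$, $j\in\mathbb{N}$, with $\|w_j-w\|_H\to0$; and (b) if $(W_{j_m})$ is a subsequence of $(W_j)$, $w_m\in W_{j_m}$ for $m\in\mathbb{N}$, and $w_m\rightharpoonup w$ weakly as $m\to\infty$,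 then $w\in W$. *)

(* Defs.v *)
From mathcomp Require Import all_boot all_order all_algebra.
From mathcomp Require Import sesquilinear complex.
From mathcomp Require Import all_classical all_reals all_analysis.

Set Implicit Arguments.
Unset Strict Implicit.
Unset Printing Implicit Defensive.

Import Order.TTheory GRing.Theory Num.Theory.
Import numFieldNormedType.Exports.

Local Open Scope classical_set_scope.
Local Open Scope ring_scope.

(* In a normed module over [R[i]] the norm takes its values in [R[i]] (they are
   real and nonnegative there); [rnorm] is the same norm with values in [R]. *)
Definition rnorm (R : realType) (V : normedZmodType R[i]) (x : V) : R :=
  complex.Re `|x|.

(* The inner product is linear in the first argument and antilinear in the
   second one. *)
Record hilbert (R : realType) := Hilbert {
  hilbert_sort :> completeNormedModType R[i];
  dotp : {dot hilbert_sort for Num.conj};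
  dotp_norm : forall u : hilbert_sort, dotp u u = `|u| ^+ 2 }.

Section HilbertSpace.
Variables (R : realType) (H : hilbert R).

Definition closed_subspace (W : set H) : Prop :=
  submod_closed [in W] /\ closed W.

Definition orthogonal_complement (S : set H) : set H :=
  [set u | forall s, S s -> dotp H u s = 0].

(* This is the orthogonal projection onto [S] when [S] is a closed subspace; the
   default value [0] is then never used. *)
Definition orthogonal_projection (S : set H) (u : H) : H :=
  xget 0 [set p | S p /\ orthogonal_complement S (u - p)].

(* The dual space consists of the continuous antilinear functionals, so that
   the pairing of a unitary realisation with [H] is sesquilinear. *)
Definition dual : set (H -> R[i]) :=
  [set l | linear_for (Num.conj \; *%R) l /\ continuous (l : H -> R[i]^o)].

Definition dual_norm (l : H -> R[i]) : R :=
  sup [set rnorm (l v) | v in [set v : H | rnorm v <= 1]].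

Definition weakly_converges (w : nat -> H) (w0 : H) : Prop :=
  forall l : H -> R[i], dual l ->
    (l (w m) : R[i]^o) @[m --> \oo] --> (l w0 : R[i]^o).

Definition mosco_converges (W_ : nat -> set H) (W : set H) : Prop :=
  (forall w, W w ->
    exists2 w_ : nat -> H, (forall j, W_ j (w_ j)) &
      rnorm (w_ j - w) @[j --> \oo] --> (0 : R)) /\
  (forall (jm : nat -> nat) (w_ : nat -> H) (w : H),
    {homo jm : m n / (m < n)%N} -> (forall m, W_ (jm m) (w_ m)) ->
    weakly_converges w_ w -> W w).

End HilbertSpace.

Section Operators.
Variables (R : realType) (H Hs : hilbert R).

Definition bounded_operator (A : {linear H -> Hs}) : Prop :=
  exists M : R, forall u, rnorm (A u) <= M * rnorm u.

Definition compact_operator (A : {linear H -> Hs}) : Prop :=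
  compact (closure (A @` [set u : H | rnorm u <= 1])).

Variable pairing : Hs -> H -> R[i].

(* A linear bijection onto [dual H] that preserves the norm is a unitary
   isomorphism, the norm of the dual space being induced by an inner product. *)
Definition unitary_realisation : Prop :=
  [/\ forall a f g v, pairing (a *: f + g) v = a * pairing f v + pairing g v,
      set_bij [set: Hs] (dual (H := H)) pairing &
      forall f, dual_norm (pairing f) = rnorm f].

Definition coercive (A : {linear H -> Hs}) : Prop :=
  bounded_operator A /\
  exists2 alpha : R, 0 < alpha &
    forall u, alpha * rnorm u ^+ 2 <= rnorm (pairing (A u) u).

Definition compactly_perturbed_coercive (A : {linear H -> Hs}) : Prop :=
  bounded_operator A /\
  exists A0 A1 : {linear H -> Hs},
    [/\ coercive A0, compact_operator A1 & forall u, A u = A0 u + A1 u].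

Definition annihilator (W : set H) : set Hs :=
  [set f | forall w, W w -> pairing f w = 0].

Definition dual_realisation (W : set H) : set Hs :=
  orthogonal_complement (annihilator W).

(* By the bounded inverse theorem the inverse is automatically bounded. *)
Definition invertible_on (A : H -> Hs) (W : set H) : Prop :=
  set_bij W (dual_realisation W)
    (orthogonal_projection (dual_realisation W) \o A).

Definition solves (A : H -> Hs) (W : set H) (f : Hs) (u : H) : Prop :=
  W u /\ forall v, W v -> pairing (A u) v = pairing f v.

(* Well-posedness in the sense of Hadamard, for all data [f]: there is a unique
   solution, and it depends continuously on [f]. *)
Definition well_posed (P : Hs -> H -> Prop) : Prop :=
  exists2 S : Hs -> H, continuous S & forall f u, P f u <-> u = S f.

End Operators.

(* Main.v *)
(* Taking real parts turns all sesquilinear problems into real bilinear ones, for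
   which minimising an energy functional gives projections, the Riesz theorem and
   the solution of symmetric coercive problems. Bounded sequences have weakly
   convergent subsequences, so a sequence of unit vectors of the spaces [Vh_ j] on
   which the form becomes small has, by Mosco convergence, a weak limit in [V]; this
   limit is [0] because [A] is invertible on [V], which contradicts the Garding
   inequality since the compact part of [A] kills weakly null sequences. Hence an
   inf-sup condition holds on [Vh_ j], uniformly for large [j]. The same argument
   applies to the transposed form, and the two conditions give well-posedness.
   Since [Vh_ j] is not contained in [V], quasi-optimality comes with a consistency
   error, which tends to [0] by weak compactness and Mosco convergence again. *)

Require Import Defs.
From mathcomp Require Import all_boot all_order all_algebra.
From mathcomp Require Import sesquilinear complex.
From mathcomp Require Import all_classical all_reals all_analysis.
From mathcomp Require Import ring lra.

Set Implicit Arguments.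
Unset Strict Implicit.
Unset Printing Implicit Defensive.

Import Order.TTheory GRing.Theory Num.Theory.
Import numFieldNormedType.Exports.

Local Open Scope classical_set_scope.
Local Open Scope ring_scope.

Local Notation "t %:C" := (real_complex _ t).

(** * Real forms on complex Hilbert spaces *)

Section NormedSpace.
Variables (R : realType) (X : normedModType R[i]).
Implicit Types (x y : X) (W : set X).

Lemma normE x : `|x| = (rnorm x)%:C.
Proof. by rewrite [RHS]RRe_real // ger0_real. Qed.

Lemma rnorm_ge0 x : 0 <= rnorm x.
Proof. by rewrite -ler0c -normE. Qed.

Lemma rnormD x y : rnorm (x + y) <= rnorm x + rnorm y.
Proof. by rewrite -lecR rmorphD /= -!normE ler_normD. Qed.

Lemma rnormN x : rnorm (- x) = rnorm x.
Proof. by rewrite /rnorm normrN. Qed.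

Lemma rnormB x y : rnorm (x - y) = rnorm (y - x).
Proof. by rewrite -rnormN opprB. Qed.

Lemma rnorm0 : rnorm (0 : X) = 0.
Proof. by rewrite /rnorm normr0. Qed.

Lemma rnorm0_eq0 x : rnorm x = 0 -> x = 0.
Proof. by move=> x0; apply/eqP; rewrite -normr_eq0 normE x0. Qed.

Lemma normc_real (t : R) : `|t%:C| = `|t|%:C.
Proof. by rewrite normc_def /= expr0n addr0 sqrtr_sqr. Qed.

Lemma rnormZ (t : R) x : rnorm (t%:C *: x) = `|t| * rnorm x.
Proof. by apply: complexI; rewrite -normE normrZ normE normc_real rmorphM. Qed.

Lemma rnorm_iZ x : rnorm ('i%C *: x) = rnorm x.
Proof.
by rewrite /rnorm normrZ normc_def /= expr0n expr1n add0r sqrtr1 mul1r.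
Qed.

Lemma rnorm_cvg (u : nat -> X) x :
  rnorm (u n - x) @[n --> \oo] --> (0 : R) <-> u n @[n --> \oo] --> x.
Proof.
split=> [ux|/cvgrPdist_lt ux].
  apply/cvgrPdist_lt => e e0.
  have Ee : e = (complex.Re e)%:C by rewrite RRe_real // gtr0_real.
  move: e0; rewrite Ee ltcR => e0.
  have /cvgrPdist_lt/(_ _ e0) := ux; apply: filterS => n.
  by rewrite sub0r normrN ger0_norm ?rnorm_ge0// normE ltcR rnormB.
apply/cvgrPdist_lt => e e0; have := ux e%:C; rewrite ltcR => /(_ e0).
apply: filterS => n; rewrite sub0r normrN ger0_norm ?rnorm_ge0//.
by rewrite normE ltcR rnormB.
Qed.

End NormedSpace.

Lemma rnorm_complete (R : realType) (X : completeNormedModType R[i])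
  (u : nat -> X) :
  (forall e : R, 0 < e ->
     exists N, forall m n, (N <= m)%N -> (N <= n)%N -> rnorm (u m - u n) < e) ->
  exists x, rnorm (u n - x) @[n --> \oo] --> (0 : R).
Proof.
move=> uC; suff /cvg_ex[x ux] : cvg (u n @[n --> \oo]).
  by exists x; apply/rnorm_cvg.
apply/cauchy_cvgP/cauchy_exP => e e0.
have Ee : e = (complex.Re e)%:C by rewrite RRe_real // gtr0_real.
move: e0; rewrite Ee ltcR => e0; have [N HN] := uC _ e0.
exists (u N).
suff: \forall n \near \oo, ball (u N) (complex.Re e)%:C (u n) by [].
exists N => // n /= Nn; rewrite -ball_normE /= normE ltcR; exact: HN.
Qed.

Lemma dominated_cvg0 (R : realType) (f g : nat -> R) :
  (forall n, `|f n| <= g n) -> g n @[n --> \oo] --> (0 : R) ->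
  f n @[n --> \oo] --> (0 : R).
Proof.
move=> fg g0; apply/norm_cvg0P.
apply: (@squeeze_cvgr _ _ _ _ (cst 0) g) => //; last exact: cvg_cst.
by apply: nearW => n; rewrite normr_ge0 fg.
Qed.

Section RealForms.
Variables (R : realType) (H : hilbert R).
Implicit Types (u v w : H) (W : set H) (L : H -> R).

(** Only real scalars are allowed, so real parts of linear and of antilinear functionals both
    qualify and the two arguments of a form become interchangeable. *)
Definition rlinear L : Prop :=
  (forall u v, L (u + v) = L u + L v) /\ (forall t u, L (t%:C *: u) = t * L u).

Lemma rlinear0 L : rlinear L -> L 0 = 0.
Proof. by case=> _ /(_ 0 0); rewrite scaler0 mul0r. Qed.

Lemma rlinearN L : rlinear L -> forall u, L (- u) = - L u.
Proof. by case=> _ /(_ (-1)) LZ u; rewrite -mulN1r -LZ rmorphN1 scaleN1r. Qed.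

Lemma rlinearB L : rlinear L -> forall u v, L (u - v) = L u - L v.
Proof. by move=> hL u v; rewrite hL.1 rlinearN. Qed.

Definition bounded_functional L : Prop :=
  rlinear L /\ exists2 N : R, 0 <= N & forall v, `|L v| <= N * rnorm v.

Definition bounded_form (c : H -> H -> R) : Prop :=
  [/\ forall v, rlinear (c^~ v), forall u, rlinear (c u) &
      exists2 M : R, 0 <= M & forall u v, `|c u v| <= M * rnorm u * rnorm v].

Lemma formDl c : bounded_form c -> forall u v w, c (u + v) w = c u w + c v w.
Proof. by case=> cl _ _ u v w; rewrite (cl w).1. Qed.

Lemma formDr c : bounded_form c -> forall u v w, c u (v + w) = c u v + c u w.
Proof. by case=> _ cr _ u v w; rewrite (cr u).1. Qed.

Lemma formZl c : bounded_form c -> forall t u v, c (t%:C *: u) v = t * c u v.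
Proof. by case=> cl _ _ t u v; rewrite (cl v).2. Qed.

Lemma formZr c : bounded_form c -> forall t u v, c u (t%:C *: v) = t * c u v.
Proof. by case=> _ cr _ t u v; rewrite (cr u).2. Qed.

Lemma formBl c : bounded_form c -> forall u v w, c (u - v) w = c u w - c v w.
Proof. by case=> cl _ _ u v w; exact: (rlinearB (cl w)). Qed.

Lemma formBr c : bounded_form c -> forall u v w, c u (v - w) = c u v - c u w.
Proof. by case=> _ cr _ u v w; exact: (rlinearB (cr u)). Qed.

Lemma form_functionalr c u : bounded_form c -> bounded_functional (c u).
Proof.
case=> _ cr [M M0 cM]; split=> //; exists (M * rnorm u) => //.
by rewrite mulr_ge0 ?rnorm_ge0.
Qed.

Lemma form_swap c : bounded_form c -> bounded_form (fun u v => c v u).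
Proof.
by case=> cl cr [M M0 cM]; split => //; exists M => // u v; rewrite mulrAC.
Qed.

Lemma form_functionall c v : bounded_form c -> bounded_functional (c^~ v).
Proof. by move=> /form_swap/form_functionalr; exact. Qed.

(** Common zero sets of real functionals are in general closed under real scalars only. Closedness
    is sequential, the form in which limits of minimising sequences use it. *)
Definition closed_rsubspace W : Prop :=
  [/\ W 0, forall u v, W u -> W v -> W (u + v),
      forall t u, W u -> W (t%:C *: u) &
      forall (u_ : nat -> H) u, (forall n, W (u_ n)) ->
        rnorm (u_ n - u) @[n --> \oo] --> (0 : R) -> W u].

Lemma closed_rsubspaceB W u v : closed_rsubspace W -> W u -> W v -> W (u - v).
Proof.
move=> [_ WD WZ _] Wu Wv; apply: WD => //.
by have := WZ (-1) _ Wv; rewrite rmorphN1 scaleN1r.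
Qed.

Lemma closed_subspaceD W u v : closed_subspace W -> W u -> W v -> W (u + v).
Proof.
move=> [[_ WL] _] Wu Wv; rewrite -[u]scale1r.
by apply/set_mem; apply: WL; exact/mem_set.
Qed.

Lemma closed_subspaceZ W (a : R[i]) u : closed_subspace W -> W u -> W (a *: u).
Proof.
move=> [[W0 WL] _] Wu; rewrite -[_ *: _]addr0.
by apply/set_mem; apply: WL => //; exact/mem_set.
Qed.

Lemma closed_subspaceB W u v : closed_subspace W -> W u -> W v -> W (u - v).
Proof.
by move=> hW Wu Wv; apply: closed_subspaceD => //; rewrite -scaleN1r;
  exact: closed_subspaceZ.
Qed.

Lemma closed_subspace_rsubspace W : closed_subspace W -> closed_rsubspace W.
Proof.
move=> hW; split.
- by apply/set_mem; case: hW => -[].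
- by move=> u v; exact: closed_subspaceD.
- by move=> t u; exact: closed_subspaceZ.
- move=> u_ u Wu /rnorm_cvg uu; apply: (closed_cvg W hW.2 _ _ uu).
  exact: nearW.
Qed.

(** This makes [H] a real Hilbert space with the same norm. *)
Definition rdot u v : R := complex.Re (dotp H u v).

Lemma rdotC u v : rdot u v = rdot v u.
Proof.
rewrite /rdot (@hermC _ _ _ _ (dotp H) u v) expr0 mul1r /=.
by case: (dotp H v u).
Qed.

Lemma rdotxx u : rdot u u = rnorm u ^+ 2.
Proof. by rewrite /rdot dotp_norm normE -rmorphXn. Qed.

Lemma rdot_rlinearl v : rlinear (rdot^~ v).
Proof.
split=> [u w|t u]; first by rewrite /rdot linearDl raddfD.
by rewrite /rdot linearZl_LR /=; case: (dotp H u v) => a b; simpc.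
Qed.

Lemma rdot_rlinearr u : rlinear (rdot u).
Proof.
by split=> [v w|t v]; rewrite rdotC; [rewrite (rdot_rlinearl u).1|
  rewrite (rdot_rlinearl u).2]; rewrite !(rdotC _ u).
Qed.

Lemma rdot_nondegenerate u : rdot u u = 0 -> u = 0.
Proof. by rewrite rdotxx => /eqP; rewrite expf_eq0 /= => /eqP/rnorm0_eq0. Qed.

Lemma rdot_cauchy_schwarz u v : `|rdot u v| <= rnorm u * rnorm v.
Proof.
have [/eqP|] := eqVneq (rnorm u * rnorm v) 0.
  rewrite mulf_eq0 => /orP[] /eqP/rnorm0_eq0 ->.
    by rewrite (rlinear0 (rdot_rlinearl v)) normr0 rnorm0 mul0r.
  by rewrite (rlinear0 (rdot_rlinearr u)) normr0 rnorm0 mulr0.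
move=> nz; have uv0 : 0 < rnorm u * rnorm v.
  by rewrite lt0r nz mulr_ge0 ?rnorm_ge0.
(* The values [s = 1] and [s = -1] give the lower and the upper bound on [rdot u v]. *)
have expand s : rnorm ((rnorm v)%:C *: u + (s * rnorm u)%:C *: v) ^+ 2 =
    (1 + s ^+ 2) * (rnorm u * rnorm v) ^+ 2 + 2 * s * (rnorm u * rnorm v) * rdot u v.
  rewrite -rdotxx !(rdot_rlinearl _).1 !(rdot_rlinearr _).1.
  rewrite !(rdot_rlinearl _).2 !(rdot_rlinearr _).2 !rdotxx (rdotC v u).
  by ring.
rewrite ler_norml; apply/andP; split; rewrite -(ler_pM2l uv0).
- by have := sqr_ge0 (rnorm ((rnorm v)%:C *: u + (1 * rnorm u)%:C *: v));
    rewrite expand; lra.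
- by have := sqr_ge0 (rnorm ((rnorm v)%:C *: u + (-1 * rnorm u)%:C *: v));
    rewrite expand; lra.
Qed.

Lemma rdot_bounded_form : bounded_form rdot.
Proof.
split; [exact: rdot_rlinearl|exact: rdot_rlinearr|exists 1 => // u v].
by rewrite mul1r; exact: rdot_cauchy_schwarz.
Qed.

Lemma bounded_functional_cvg L (u_ : nat -> H) u : bounded_functional L ->
  rnorm (u_ n - u) @[n --> \oo] --> (0 : R) -> L (u_ n) @[n --> \oo] --> L u.
Proof.
move=> [hL [N N0 LN]] u_u; apply/subr_cvg0.
apply: (@dominated_cvg0 _ _ (fun n => N * rnorm (u_ n - u))).
  by move=> n; rewrite -rlinearB.
by rewrite -[X in _ --> X](mulr0 N); exact: cvgMl_tmp.
Qed.

End RealForms.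

(** * Minimisation of quadratic energy functionals *)

Section Representation.
Variables (R : realType) (H : hilbert R).
Implicit Types (u v w : H) (W : set H) (L : H -> R).

(** If [D] were nonzero, [t = - D / (C + 1)] would give the negative value [- (D / (C + 1)) ^+ 2];
    the added 1 keeps the denominator positive. *)
Lemma quadratic_ge0_eq0 (D C : R) :
  (forall t, 0 <= t * D + t ^+ 2 * C) -> 0 <= C -> D = 0.
Proof.
move=> h C0; apply/eqP/negPn/negP => D0.
have := h (- D / (C + 1)); have C1 : 0 < C + 1 by lra.
have -> : - D / (C + 1) * D + (- D / (C + 1)) ^+ 2 * C = - (D / (C + 1)) ^+ 2.
  by field; rewrite gt_eqF.
by rewrite oppr_ge0 leNgt exprn_even_gt0 //= mulf_neq0 // invr_neq0 ?gt_eqF.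
Qed.

(* Minimises [c v v - 2 L v] over [W]; a minimising sequence is Cauchy by the
   parallelogram identity for [c]. *)
Lemma symmetric_lax_milgram W (c : H -> H -> R) (alpha : R) L :
  closed_rsubspace W -> bounded_form c -> (forall u v, c u v = c v u) ->
  0 < alpha -> (forall v, W v -> alpha * rnorm v ^+ 2 <= c v v) ->
  bounded_functional L ->
  exists2 w, W w & forall v, W v -> c w v = L v.
Proof.
move=> hW hc csym alpha0 calpha hL; have [hLl [N N0 LN]] := hL.
have [W0 WD WZ Wcl] := hW.
pose J v := c v v - 2 * L v.
pose E := J @` W.
(* The bound comes from completing the square in [alpha * r ^+ 2 - 2 * N * r], with [r] the norm of
   [v]. *)
have Elb : lbound E (- (N ^+ 2 / alpha)).
  move=> _ [v Wv <-]; rewrite /J.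
  have := calpha _ Wv; have := LN v; rewrite ler_norml => /andP[_ LNv] cv.
  have : 0 <= (alpha * rnorm v - N) ^+ 2 / alpha.
    by rewrite divr_ge0 ?sqr_ge0 ?ltW.
  have -> : (alpha * rnorm v - N) ^+ 2 / alpha =
      alpha * rnorm v ^+ 2 - 2 * (N * rnorm v) + N ^+ 2 / alpha.
    by field; rewrite gt_eqF.
  lra.
have Einf : has_inf E by split; [exists (J 0), 0|exists (- (N ^+ 2 / alpha))].
pose m := inf E.
have Jm v : W v -> m <= J v.
  by move=> Wv; apply: ge_inf; [case: Einf|exists v].
have /choice[x_ x_P] n : exists x, W x /\ J x < m + n.+1%:R^-1.
  have n0 : 0 < n.+1%:R^-1 :> R by rewrite invr_gt0.
  by have [_ [x Wx <-] xlt] := inf_adherent n0 Einf; exists x.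
(* Parallelogram identity, with [m <= J] at the midpoint of [x] and [y]; the linear terms cancel. *)
have par x y : W x -> W y ->
    alpha * rnorm (x - y) ^+ 2 <= 2 * (J x - m) + 2 * (J y - m).
  move=> Wx Wy; have := calpha _ (closed_rsubspaceB hW Wx Wy).
  have := Jm _ (WZ (2^-1) _ (WD _ _ Wx Wy)); rewrite /J.
  rewrite !(formBl hc) !(formBr hc) !(formZl hc) !(formZr hc).
  rewrite !(formDl hc) !(formDr hc) (csym y x) hLl.2 hLl.1; lra.
have [w xw] : exists w, rnorm (x_ n - w) @[n --> \oo] --> (0 : R).
  apply: rnorm_complete => e e0.
  have d0 : 0 < alpha * e ^+ 2 / 4 by rewrite divr_gt0 // mulr_gt0 // exprn_gt0.
  have [K _ KP] := near_infty_natSinv_lt (PosNum d0).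
  exists K => p q Kp Kq; rewrite ltNge; apply/negP => ple.
  have := par _ _ (x_P p).1 (x_P q).1.
  have := (x_P p).2; have := (x_P q).2.
  have : p.+1%:R^-1 < alpha * e ^+ 2 / 4 by exact: (KP _ Kp).
  have : q.+1%:R^-1 < alpha * e ^+ 2 / 4 by exact: (KP _ Kq).
  have : alpha * e ^+ 2 <= alpha * rnorm (x_ p - x_ q) ^+ 2.
    by rewrite ler_pM2l // lerXn2r // nnegrE ?rnorm_ge0 // ltW.
  by move: (p.+1%:R^-1) (q.+1%:R^-1) => ? ?; lra.
have Ww : W w by apply: Wcl xw => n; exact: (x_P n).1.
exists w => // v Wv.
have cvv : 0 <= c v v by rewrite (le_trans _ (calpha _ Wv)) // mulr_ge0 ?sqr_ge0 ?ltW.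
suff /eqP : 2 * (c w v - L v) = 0 by rewrite mulf_eq0 pnatr_eq0 subr_eq0 => /eqP.
(* Compare [J (x_ n + t v) >= m] with [J (x_ n) < m + 1/(n+1)] and let [n] grow: only [c (x_ n) v]
   needs a limit, not [J (x_ n)]. *)
apply: (quadratic_ge0_eq0 _ cvv) => t.
have lim : t * (2 * (c (x_ n) v - L v)) + t ^+ 2 * c v v + n.+1%:R^-1 @[n --> \oo]
     --> t * (2 * (c w v - L v)) + t ^+ 2 * c v v + 0.
  apply: cvgD; last exact: cvg_harmonic.
  apply: cvgD; last exact: cvg_cst.
  apply: cvgMl_tmp; apply: cvgMl_tmp; apply: cvgB; last exact: cvg_cst.
  exact: bounded_functional_cvg (form_functionall v hc) xw.
rewrite -[leRHS]addr0; apply: (cvgr_to_ge lim); apply: nearW => n.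
have [Wx Jx] := x_P n; have := Jm _ (WD _ _ Wx (WZ t _ Wv)); move: Jx; rewrite /J.
rewrite (formDl hc) !(formDr hc) !(formZl hc) !(formZr hc) (csym v) hLl.1 hLl.2.
by move: (n.+1%:R^-1) => ?; lra.
Qed.

End Representation.

(** * Weak compactness *)

Section WeakCompactness.
Variables (R : realType) (H : hilbert R).
Implicit Types (u v w : H) (W : set H) (L : H -> R).

(** Taking [L = rdot u] yields orthogonal projections, and taking [W] to be the whole space yields
    the Riesz theorem. *)
Lemma rdot_symmetric_lax_milgram W L : closed_rsubspace W ->
  bounded_functional L -> exists2 w, W w & forall v, W v -> rdot w v = L v.
Proof.
move=> hW; apply: (symmetric_lax_milgram (alpha := 1)) => //.
- exact: rdot_bounded_form.
- exact: rdotC.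
- by move=> v _; rewrite mul1r rdotxx.
Qed.

Lemma rdot_projection W u : closed_rsubspace W ->
  exists2 p, W p & forall v, W v -> rdot (u - p) v = 0.
Proof.
move=> hW; have hL := form_functionalr u (rdot_bounded_form H).
have [p Wp pP] := rdot_symmetric_lax_milgram hW hL.
exists p => // v Wv; rewrite (formBl (rdot_bounded_form H)) (pP v Wv) subrr //.
Qed.

Lemma rdot_riesz L : bounded_functional L -> exists w, forall v, rdot w v = L v.
Proof.
move=> hL; have hT : closed_rsubspace [set: H] by split.
by have [w _ wP] := rdot_symmetric_lax_milgram hT hL; exists w => v; exact: wP.
Qed.

Lemma increasing_extraction (Q : nat -> nat -> Prop) :
  (forall m N, exists2 n, (N <= n)%N & Q m n) ->
  exists2 phi : nat -> nat, {homo phi : m n / (m < n)%N} & forall m, Q m (phi m).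
Proof.
move=> QP.
have /choice[f fP] (mN : nat * nat) : exists n, (mN.2 <= n)%N /\ Q mN.1 n.
  by have [n ? ?] := QP mN.1 mN.2; exists n.
pose phi := fix phi m := if m is k.+1 then f (m, (phi k).+1) else f (0, 0)%N.
exists phi => [|[|m]]; [|exact: (fP (_, _)).2|exact: (fP (_, _)).2].
apply: (homo_ltn ltn_trans) => m.
exact: (fP (m.+1, (phi m).+1)).1.
Qed.

(** [F] contains the preimage of [B] or that of its complement; for [B] in a finer proper filter [G]
    the latter would put the empty set into [G]. *)
Lemma fmap_ultrafilter (T U : Type) (f : T -> U) (F : set_system T) :
  UltraFilter F -> UltraFilter (fmap f F).
Proof.
move=> FU; split; first exact: fmap_proper_filter.
move=> G GF sFG; apply/seteqP; split=> // B GB.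
have [//|FnB] := in_ultra_setVsetC (f @^-1` B) FU.
by have /filter_ex[? []] : G (B `&` ~` B) by apply: filterI => //; exact: sFG.
Qed.

Lemma bounded_ultralimit (F : set_system nat) (a : nat -> R) (M : R) :
  UltraFilter F -> (forall n, `|a n| <= M) ->
  exists2 l, `|l| <= M & a n @[n --> F] --> l.
Proof.
move=> FU aM; have := segment_compact (a := - M) (b := M); rewrite compact_ultra.
move=> /(_ (a @ F) (fmap_ultrafilter a FU)) [].
  by apply: (@filterE _ F) => n /=; rewrite in_itv /= -ler_norml; exact: aM.
by move=> l [/=]; rewrite in_itv /= -ler_norml => lM al; exists l.
Qed.

(* The weak limit represents the limit functional along an ultrafilter. Testing
   against the [x k] only is enough: the set [G] of good test vectors is a closed
   subspace, and vectors orthogonal to all [x k] are good. *)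
Lemma weak_sequential_compactness (x : nat -> H) : (forall n, rnorm (x n) <= 1) ->
  exists2 phi : nat -> nat, {homo phi : m n / (m < n)%N} &
    exists w, forall v, rdot (x (phi m)) v @[m --> \oo] --> rdot w v.
Proof.
move=> x1; have hr := rdot_bounded_form H.
have rx n v : `|rdot (x n) v| <= rnorm v.
  by apply: le_trans (rdot_cauchy_schwarz _ _) _; rewrite ler_piMl ?rnorm_ge0.
have [U [UU Uoo]] := ultraFilterLemma (F := \oo) _.
have PU : ProperFilter U := ultra_proper.
(* All limits are taken along the same [U], so [L] inherits real linearity. *)
have /choice[L LP] v : exists l, `|l| <= rnorm v /\ rdot (x n) v @[n --> U] --> l.
  have [l lM xl] := bounded_ultralimit (a := fun n => rdot (x n) v) UU (rx^~ v).
  by exists l.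
have hL : bounded_functional L.
  split; last by exists 1 => // v; rewrite mul1r (LP v).1.
  split=> [u v|t u]; apply: (cvg_unique _ (LP _).2) => //=.
    under eq_fun do rewrite (formDr hr); apply: cvgD; exact: (LP _).2.
  under eq_fun do rewrite (formZr hr); apply: cvgMl_tmp; exact: (LP _).2.
have [w wL] := rdot_riesz hL.
(* Finitely many conditions for each [m], so they hold jointly on a set of [U]; as [U] refines
   [\oo], such [n] occur arbitrarily late. *)
pose Q m n := forall k : 'I_m.+1, `|rdot (x n) (x k) - rdot w (x k)| < m.+1%:R^-1.
have [phi phi_incr phiQ] : exists2 phi : nat -> nat,
    {homo phi : m n / (m < n)%N} & forall m, Q m (phi m).
  apply: increasing_extraction => m N.
  have UN : U [set n | (N <= n)%N] by apply: Uoo; exact: nbhs_infty_ge.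
  have UQ : \forall n \near U, Q m n.
    apply: filter_forall => k; rewrite wL.
    have := (LP (x k)).2 => /cvgrPdist_lt/(_ m.+1%:R^-1).
    by rewrite invr_gt0 ltr0n => /(_ isT); apply: filterS => n; rewrite distrC.
  have [n [Nn Qn]] := filter_ex (filterI UN UQ).
  by exists n.
exists phi => //; exists w.
pose G v := rdot (x (phi m)) v @[m --> \oo] --> rdot w v.
have Gx k : G (x k).
  apply/subr_cvg0/norm_cvg0P.
  apply: (@squeeze_cvgr _ _ _ _ (cst 0) harmonic); last 2 first.
  - exact: cvg_cst.
  - exact: cvg_harmonic.
  near=> m; rewrite normr_ge0 /=.
  have km : (k < m.+1)%N by rewrite ltnS; near: m; exact: nbhs_infty_ge.
  exact: ltW (phiQ m (Ordinal km)).
have hG : closed_rsubspace G.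
  split.
  - rewrite /G (rlinear0 (rdot_rlinearr _)).
    by under eq_fun do rewrite (rlinear0 (rdot_rlinearr _)); exact: cvg_cst.
  - move=> u v Gu Gv; rewrite /G (formDr hr).
    by under eq_fun do rewrite (formDr hr); exact: cvgD.
  - move=> t u Gu; rewrite /G (formZr hr).
    by under eq_fun do rewrite (formZr hr); exact: cvgMl_tmp.
  - move=> v_ v Gv /cvgrPdist_lt v_v; apply/subr_cvg0/cvgr0Pnorm_lt => e e0.
    (* [1 + rnorm w] bounds the norm of [x (phi m) - w], so replacing [v] by [v_ N] costs less than
       [e / 2]. *)
    have M0 : 0 < 2 * (1 + rnorm w) by rewrite mulr_gt0 // ltr_wpDr ?rnorm_ge0.
    have [N _ /(_ N (leqnn N))] := v_v (e / (2 * (1 + rnorm w))) (divr_gt0 e0 M0).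
    rewrite /= sub0r normrN ger0_norm ?rnorm_ge0// ltr_pdivlMr // => vN.
    have e2 : 0 < e / 2 by lra.
    have /subr_cvg0/cvgr0Pnorm_lt/(_ _ e2) := Gv N; apply: filterS => m.
    rewrite -!(formBl hr) => mN.
    have -> : v = v_ N - (v_ N - v) by rewrite opprB addrC subrK.
    rewrite (formBr hr) (le_lt_trans (ler_normB _ _)) //.
    have : `|rdot (x (phi m) - w) (v_ N - v)| <= (1 + rnorm w) * rnorm (v_ N - v).
      rewrite (le_trans (rdot_cauchy_schwarz _ _)) // ler_wpM2r ?rnorm_ge0 //.
      by rewrite (le_trans (rnormD _ _)) // rnormN lerD2r.
    lra.
move=> v; have [p Gp vp] := rdot_projection v hG.
suff Gvp : G (v - p) by rewrite -[v](subrK p); case: hG => _ GD _ _; exact: GD.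
have xvp n : rdot (x n) (v - p) = 0 by rewrite rdotC; exact: vp.
suff wvp : rdot w (v - p) = 0.
  by rewrite /G wvp; under eq_fun do rewrite xvp; exact: cvg_cst.
rewrite wL; apply: (cvg_unique _ (LP _).2) => //=.
by under eq_fun do rewrite xvp; exact: cvg_cst.
Unshelve. all: by end_near. Qed.

Lemma bounded_functional_weak_cvg (x : nat -> H) w L :
  (forall v, rdot (x m) v @[m --> \oo] --> rdot w v) -> bounded_functional L ->
  L (x m) @[m --> \oo] --> L w.
Proof.
move=> xw /rdot_riesz[r rL]; rewrite -rL rdotC.
by under eq_fun do rewrite -rL rdotC; exact: xw.
Qed.

End WeakCompactness.

(** * Compact operators on weakly null sequences *)

Section CompactOperators.
Variables (R : realType) (H Hs : hilbert R).

Lemma nbhs_rnorm (X : normedModType R[i]) (x : X) (e : R) :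
  0 < e -> nbhs x [set y | rnorm (x - y) < e].
Proof.
move=> e0; have eC : 0 < e%:C by rewrite ltcR.
apply: filterS (nbhsx_ballx x _ eC) => y.
by rewrite -ball_normE /= normE ltcR.
Qed.

Lemma bounded_operator_functional (K : {linear H -> Hs}) (L : Hs -> R) :
  bounded_operator K -> bounded_functional L -> bounded_functional (L \o K).
Proof.
move=> [M KM] [[LD LZ] [N N0 LN]]; split.
  by split=> [u v|t u] /=; rewrite ?linearD ?linearZ /= ?LD ?LZ.
exists (N * `|M|) => [|u]; first by rewrite mulr_ge0.
rewrite (le_trans (LN _)) // -mulrA ler_wpM2l // (le_trans (KM u)) //.
by rewrite ler_wpM2r ?rnorm_ge0 // ler_norm.
Qed.

(** By compactness the images have a cluster point [g] in norm, and weak continuity of [K] forces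
    [g = 0]. Smallness at arbitrarily late indices is all that the contradiction argument below
    requires. *)
Lemma compact_operator_weakly_null (K : {linear H -> Hs}) (x : nat -> H) :
  bounded_operator K -> compact_operator K -> (forall n, rnorm (x n) <= 1) ->
  (forall v, rdot (x m) v @[m --> \oo] --> (0 : R)) ->
  forall (e : R) N, 0 < e -> exists2 m, (N <= m)%N & rnorm (K (x m)) < e.
Proof.
move=> Kb Kc x1 x0; have hr := rdot_bounded_form Hs.
have [|g [_ Kg]] := Kc ((K \o x) n @[n --> \oo]) _.
  by apply: (@filterE _ \oo) => n /=; apply: subset_closure; exists (x n) => //=.
have Kg_near N (e : R) : 0 < e -> exists2 m, (N <= m)%N & rnorm (g - K (x m)) < e.
  move=> e0; have := Kg [set K (x m) | m in [set m | (N <= m)%N]] _ _ (nbhs_rnorm g e0).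
  case; last by move=> _ [[m /= Nm <-] ?]; exists m.
  by exists N => // n /= Nn; exists n.
have Kx0 : rdot (K (x m)) g @[m --> \oo] --> (0 : R).
  have hL := bounded_operator_functional Kb (form_functionall g hr).
  have := bounded_functional_weak_cvg (x := x) (w := 0) _ hL.
  rewrite /= linear0 (rlinear0 (rdot_rlinearl g)); apply => v.
  by rewrite (rlinear0 (rdot_rlinearl v)); exact: x0.
have g0 : g = 0.
  apply: rdot_nondegenerate; apply/eqP/negPn/negP; rewrite rdotxx => gN0.
  have gg0 : 0 < rnorm g ^+ 2 by rewrite lt0r gN0 sqr_ge0.
  have g1 : 0 < 2 * (rnorm g + 1).
    by rewrite mulr_gt0 // ltr_wpDl ?rnorm_ge0.
  (* With this tolerance [rdot (g - K (x m)) g + rdot (K (x m)) g], which equals [rnorm g ^+ 2],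
     would be at most half of itself. *)
  have e0 := divr_gt0 gg0 g1.
  have /cvgr0Pnorm_lt/(_ _ e0)[N _ NP] := Kx0.
  have [m Nm] := Kg_near N _ e0.
  have := NP _ Nm; rewrite !ltr_pdivlMr // => mN gm.
  have := rdot_cauchy_schwarz (g - K (x m)) g.
  rewrite (formBl hr) ler_norml rdotxx => /andP[_ le_gm].
  have G0 := rnorm_ge0 g; have rr := ler_norm (rdot (K (x m)) g).
  have := ler_wpM2r G0 (ltW gm).
  have := ler_wpM2r G0 le_gm.
  nra.
move=> e N e0; have [m Nm] := Kg_near N e e0.
by rewrite g0 sub0r rnormN; exists m.
Qed.

End CompactOperators.

(** * Uniform stability *)

Section UniformStability.
Variables (R : realType) (H Hs : hilbert R).
Variables (V : set H) (Vh_ : nat -> set H).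

Definition weak_limits_in : Prop :=
  forall (phi : nat -> nat) (x : nat -> H) (w : H),
    {homo phi : m n / (m < n)%N} -> (forall m, Vh_ (phi m) (x m)) ->
    (forall v, rdot (x m) v @[m --> \oo] --> rdot w v) -> V w.

(** The approximation hypothesis without infima, and for all of [V] instead of a dense subspace. *)
Definition asymptotically_dense : Prop :=
  forall v, V v -> forall e : R, 0 < e -> exists J, forall j, (J <= j)%N ->
    exists2 v', Vh_ j v' & rnorm (v - v') < e.

Hypothesis Vh_subspace : forall j, closed_subspace (Vh_ j).
Hypothesis Vh_weak : weak_limits_in.

(* Contradiction by weak compactness: almost-null unit vectors [x m] for [b] would
   converge weakly to some [w] in [V] with [b w = 0] on [V], so [w = 0]; compactness
   of [K] then contradicts the Garding inequality at [x m]. *)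
Lemma uniform_inf_sup (b : H -> H -> R) (K : {linear H -> Hs}) (alpha : R) :
  asymptotically_dense ->
  bounded_form b -> bounded_operator K -> compact_operator K -> 0 < alpha ->
  (forall u, alpha * rnorm u ^+ 2 <=
     `|b u u| + `|b u ('i%C *: u)| + 2 * rnorm (K u) * rnorm u) ->
  (forall w, V w -> (forall v, V v -> b w v = 0) -> w = 0) ->
  exists2 beta : R, 0 < beta & exists J, forall j, (J <= j)%N ->
    forall u C, Vh_ j u -> 0 <= C ->
      (forall v, Vh_ j v -> `|b u v| <= C * rnorm v) -> beta * rnorm u <= C.
Proof.
move=> Vh_dense hb Kb Kc alpha0 garding injV.
apply: contrapT => /forall2NP NbJ.
pose Q m j := exists u, [/\ Vh_ j u, rnorm u = 1 &
  forall v, Vh_ j v -> `|b u v| <= m.+1%:R^-1 * rnorm v].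
have QP m N : exists2 j, (N <= j)%N & Q m j.
  have m0 : 0 < m.+1%:R^-1 :> R by rewrite invr_gt0.
  have [//|/forallNP/(_ N)] := NbJ m.+1%:R^-1.
  move=> /existsNP[j /not_implyP[Nj /existsNP[u /existsNP[C]]]].
  move=> /not_implyP[ju /not_implyP[C0 /not_implyP[buC /negP]]].
  rewrite -ltNge => Cu; exists j => //.
  have u0 : 0 < rnorm u by rewrite -(pmulr_rgt0 _ m0) (le_lt_trans C0).
  exists ((rnorm u)^-1%:C *: u); split.
  - exact: closed_subspaceZ.
  - by rewrite rnormZ ger0_norm ?invr_ge0 ?rnorm_ge0 // mulVf ?gt_eqF.
  - move=> v jv; rewrite (formZl hb) normrM ger0_norm ?invr_ge0 ?rnorm_ge0 //.
    rewrite mulrC ler_pdivrMr // (le_trans (buC _ jv)) // mulrAC.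
    by rewrite ler_wpM2r ?rnorm_ge0 // ltW.
have [phi phi_incr /choice[x xP]] := increasing_extraction QP.
have x1 n : rnorm (x n) <= 1 by have [_ -> _] := xP n.
have [psi psi_incr [w xw]] := weak_sequential_compactness x1.
have psi_ge m : (m <= psi m)%N.
  by elim: m => // m IH; exact: leq_ltn_trans IH (psi_incr _ _ (ltnSn m)).
have psi_inv m : (psi m).+1%:R^-1 <= m.+1%:R^-1 :> R.
  by rewrite lef_pV2 ?posrE ?ltr0n // ler_nat ltnS psi_ge.
have phi_ge m : (m <= phi m)%N.
  by elim: m => // m IH; exact: leq_ltn_trans IH (phi_incr _ _ (ltnSn m)).
have Vw : V w.
  apply: (Vh_weak (phi := phi \o psi) _ _ xw).
    by move=> m n /psi_incr/phi_incr.
  by move=> m; have [] := xP (psi m).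
have w0 : w = 0.
  apply: injV => // v Vv; have [_ _ [M M0 bM]] := hb.
  apply: (cvg_unique _ (bounded_functional_weak_cvg xw (form_functionall v hb))) => //=.
  apply/cvgr0Pnorm_lt => e e0.
  (* Split [v] into [v - v'] and [v']. Continuity of [b] makes the first part less than [e / 2]; the
     second is at most [rnorm v' / (psi m + 1)], where [rnorm v'] is controlled by
     [rnorm v + e / (2 * (M + 1))]. *)
  have M1 : 0 < 2 * (M + 1) by rewrite mulr_gt0 // ltr_wpDl.
  have [J JP] := Vh_dense v Vv _ (divr_gt0 e0 M1).
  have v1 : 0 < 2 * (rnorm v + e / (2 * (M + 1))).
    by rewrite mulr_gt0 // ltr_wpDl ?rnorm_ge0 // divr_gt0.
  have := near_infty_natSinv_lt (PosNum (divr_gt0 e0 v1)).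
  move=> near_inv; near=> m.
  have Jm : (J <= phi (psi m))%N.
    rewrite (leq_trans _ (phi_ge _)) // (leq_trans _ (psi_ge _)) //.
    by near: m; exact: nbhs_infty_ge.
  have [v' jv' vv'] := JP _ Jm; have [_ xn xb] := xP (psi m).
  suff : `|b (x (psi m)) (v - v')| + `|b (x (psi m)) v'| < e.
    apply: le_lt_trans.
    by rewrite -[v in leLHS](subrK v') (formDr hb _ (v - v')) ler_normD.
  have : `|b (x (psi m)) (v - v')| <= M * rnorm (v - v').
    by rewrite -[M]mulr1 -xn.
  have := xb _ jv'.
  have : rnorm v' <= rnorm v + rnorm (v - v').
    have -> : v' = v - (v - v') by rewrite subKr.
    by rewrite (le_trans (rnormD _ _)) // rnormN subKr.
  have : (psi m).+1%:R^-1 < e / (2 * (rnorm v + e / (2 * (M + 1)))).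
    by rewrite (le_lt_trans (psi_inv m)) //; near: m.
  move: vv'; rewrite ltr_pdivlMr // => vv'.
  rewrite ltr_pdivlMr //.
  have : 0 <= (psi m).+1%:R^-1 :> R by rewrite invr_ge0.
  move: ((psi m).+1%:R^-1) (`|b _ v'|) (`|b _ (v - v')|) => d s t d0 dv v'v sd tM.
  have : d * rnorm v' <= d * (rnorm v + rnorm (v - v')) by rewrite ler_wpM2l.
  have : d * rnorm (v - v') <= d * (e / (2 * (M + 1))).
    by rewrite ler_wpM2l // ltW // ltr_pdivlMr.
  have := rnorm_ge0 (v - v').
  have : t < e / 2 by have := rnorm_ge0 (v - v'); nra.
  lra.
have xw0 v : rdot (x (psi m)) v @[m --> \oo] --> (0 : R).
  by rewrite -(rlinear0 (rdot_rlinearl v)) -w0; exact: xw.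
(* At a unit vector the two form terms are below [alpha / 8] each and the compact term below
   [alpha / 4], so the Garding inequality would give [alpha < alpha / 2]. *)
have a8 : 0 < alpha / 8 by rewrite divr_gt0.
have [N _ NP] := near_infty_natSinv_lt (PosNum a8).
have [m Nm Km] := compact_operator_weakly_null (x := x \o psi) Kb Kc
  (fun n => x1 (psi n)) xw0 N a8.
have [jx xn xb] := xP (psi m).
have := garding (x (psi m)); rewrite xn expr1n !mulr1.
have := xb _ jx; have := xb _ (closed_subspaceZ 'i%C (Vh_subspace _) jx).
rewrite rnorm_iZ xn !mulr1.
have : (psi m).+1%:R^-1 < alpha / 8.
  by rewrite (le_lt_trans (psi_inv m)) //; exact: NP.
by move: Km; move: ((psi m).+1%:R^-1) => d /=; lra.
Unshelve. all: by end_near. Qed.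

(* [Vh_ j] need not be contained in [V], hence this bound on the consistency
   error. *)
Lemma annihilating_functional_small (L : H -> R) : bounded_functional L ->
  (forall v, V v -> L v = 0) ->
  forall e : R, 0 < e -> exists J, forall j, (J <= j)%N ->
    forall v, Vh_ j v -> `|L v| <= e * rnorm v.
Proof.
move=> hL LV e e0; apply: contrapT => /forallNP NJ.
have [[LD LZ] _] := hL.
(* Late violations, normalised, have a subsequence with weak limit in [V], where [L] vanishes,
   although [L] stays above [e] in modulus along it. *)
have QP (m N : nat) : exists2 j, (N <= j)%N &
    exists v, [/\ Vh_ j v, rnorm v = 1 & e < `|L v|].
  have /existsNP[j /not_implyP[Nj /existsNP[v /not_implyP[jv /negP]]]] := NJ N.
  rewrite -ltNge => evL; exists j => //.
  have v0 : 0 < rnorm v.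
    rewrite lt0r rnorm_ge0 andbT; apply/eqP => v0; move: evL.
    by rewrite v0 (rnorm0_eq0 v0) rlinear0 // normr0 mulr0 ltxx.
  exists ((rnorm v)^-1%:C *: v); split.
  - exact: closed_subspaceZ.
  - by rewrite rnormZ ger0_norm ?invr_ge0 ?rnorm_ge0 // mulVf ?gt_eqF.
  - rewrite LZ normrM ger0_norm ?invr_ge0 ?rnorm_ge0 //.
    by rewrite mulrC ltr_pdivlMr.
have [phi phi_incr /choice[x xP]] := increasing_extraction QP.
have x1 n : rnorm (x n) <= 1 by have [_ -> _] := xP n.
have [psi psi_incr [w xw]] := weak_sequential_compactness x1.
have Vw : V w.
  apply: (Vh_weak (phi := phi \o psi) _ _ xw).
    by move=> m n /psi_incr/phi_incr.
  by move=> m; have [] := xP (psi m).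
have := bounded_functional_weak_cvg xw hL; rewrite (LV _ Vw).
move=> /cvgr0Pnorm_lt/(_ _ e0)[N _ /(_ N (leqnn N)) /=].
by have [_ _] := xP (psi N) => /lt_trans/[apply]; rewrite ltxx.
Qed.

End UniformStability.

(** * Solvability *)

Section Solvability.
Variables (R : realType) (H : hilbert R).

(* With [T] the adjoint of [b] relative to [W], the solution is [u = T w] where
   [w] solves the symmetric coercive problem [rdot (T w) (T v) = L v]. *)
Lemma inf_sup_solvable (W : set H) (b : H -> H -> R) (beta : R) (L : H -> R) :
  closed_rsubspace W -> bounded_form b -> 0 < beta ->
  (forall v C, W v -> 0 <= C ->
     (forall u, W u -> `|b u v| <= C * rnorm u) -> beta * rnorm v <= C) ->
  bounded_functional L ->
  exists2 u, W u & forall v, W v -> b u v = L v.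
Proof.
move=> hW hb beta0 inf_sup hL; have hr := rdot_bounded_form H.
have /choice[T TP] v : exists t, W t /\ forall u, W u -> rdot t u = b u v.
  have [t Wt tP] := rdot_symmetric_lax_milgram hW (form_functionall v hb).
  by exists t.
have [W0 WD WZ _] := hW; have WT v : W (T v) by have [] := TP v.
have rT v u : W u -> rdot (T v) u = b u v by move=> Wu; have [_ ->] := TP v.
have eqT (s t : H) : W s -> W t -> (forall u, W u -> rdot s u = rdot t u) -> s = t.
  move=> Ws Wt st; apply/eqP; rewrite -subr_eq0; apply/eqP/rdot_nondegenerate.
  by rewrite (formBl hr) st ?subrr //; exact: closed_rsubspaceB.
have TD u v : T (u + v) = T u + T v.
  apply: eqT => [||w Ww]; [exact: WT|by apply: WD|].
  by rewrite (formDl hr) !rT // (formDr hb).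
have TZ t u : T (t%:C *: u) = t%:C *: T u.
  apply: eqT => [||w Ww]; [exact: WT|by apply: WZ|].
  by rewrite (formZl hr) !rT // (formZr hb).
have [_ _ [M M0 bM]] := hb.
have TM v : rnorm (T v) <= M * rnorm v.
  have [->|T0] := eqVneq (rnorm (T v)) 0; first by rewrite mulr_ge0 ?rnorm_ge0.
  have {}T0 : 0 < rnorm (T v) by rewrite lt0r T0 rnorm_ge0.
  rewrite -(ler_pM2l T0) -expr2 -rdotxx rT // mulrCA mulrA.
  by rewrite (le_trans (ler_norm _)).
have hc : bounded_form (fun u v => rdot (T u) (T v)).
  split=> [v|u|].
  - by split=> [u w|t u] /=; rewrite ?TD ?TZ ?(formDl hr) ?(formZl hr).
  - by split=> [v w|t v] /=; rewrite ?TD ?TZ ?(formDr hr) ?(formZr hr).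
  - exists (M * M) => [|u v]; first exact: mulr_ge0.
    rewrite (le_trans (rdot_cauchy_schwarz _ _)) //.
    by rewrite -mulrA mulrACA ler_pM ?rnorm_ge0.
have [||v Wv|w Ww wP] := symmetric_lax_milgram (alpha := beta ^+ 2) hW hc _ _ _ hL.
- by move=> u v; exact: rdotC.
- by rewrite exprn_gt0.
(* Coercivity: [b u v = rdot (T v) u] is bounded by [rnorm (T v) * rnorm u], so the inf-sup
   condition gives [beta * rnorm v <= rnorm (T v)]. *)
- have b0 := ltW beta0.
  rewrite rdotxx -exprMn lerXn2r ?nnegrE ?mulr_ge0 ?rnorm_ge0 //.
  apply: inf_sup => //; first exact: rnorm_ge0.
  by move=> u Wu; rewrite -rT // rdot_cauchy_schwarz.
by exists (T w) => // v Wv; rewrite -rT // rdotC wP.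
Qed.

End Solvability.

(** * Antilinear functionals and their real parts *)

Section DualPairing.
Variables (R : realType) (H : hilbert R).

Lemma Re_le_rnorm (z : R[i]) : `|complex.Re z| <= rnorm z.
Proof.
by rewrite /rnorm normc_def /= -sqrtr_sqr ler_wsqrtr // lerDl sqr_ge0.
Qed.

Lemma rnorm_le_ReIm (z : R[i]) :
  rnorm z <= `|complex.Re z| + `|complex.Im z|.
Proof.
rewrite /rnorm normc_def /= -[leRHS]ger0_norm ?addr_ge0 // -sqrtr_sqr.
rewrite ler_wsqrtr // -[X in X + _ <= _]real_normK ?num_real //.
rewrite -[X in _ + X <= _]real_normK ?num_real //.
by rewrite sqrrD lerD2r lerDl mulrn_wge0 ?mulr_ge0.
Qed.

Definition antilinear (l : H -> R[i]) : Prop := linear_for (Num.conj \; *%R) l.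

Section Antilinear.
Variable l : H -> R[i].
Hypothesis hl : antilinear l.

Lemma antilinear0 : l 0 = 0.
Proof.
by have := hl 1 0 0; rewrite scaler0 addr0 /= rmorph1 mul1r => /eqP;
  rewrite -subr_eq0 opprD addrA subrr sub0r oppr_eq0 => /eqP.
Qed.

Lemma antilinearD u v : l (u + v) = l u + l v.
Proof. by have := hl 1 u v; rewrite scale1r /= rmorph1 mul1r. Qed.

Lemma antilinearZ a u : l (a *: u) = Num.conj a * l u.
Proof. by have := hl a u 0; rewrite addr0 antilinear0 addr0. Qed.

Lemma antilinear_Zreal (t : R) u : l (t%:C *: u) = t%:C * l u.
Proof. by rewrite antilinearZ; congr (_ * _); exact: conjc_real. Qed.

(** Antilinearity multiplies [l u] by [-i]. Hence the real part determines the functional, and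
    passing to real forms loses nothing on complex subspaces. *)
Lemma antilinear_Im u : complex.Im (l u) = complex.Re (l ('i%C *: u)).
Proof.
by rewrite antilinearZ /=; case: (l u) => x y /=; rewrite mul0r mulN1r sub0r opprK.
Qed.

Lemma antilinear_rlinear : rlinear (fun v => complex.Re (l v)).
Proof.
split=> [u v|t u]; first by rewrite antilinearD raddfD.
by rewrite antilinear_Zreal; case: (l u) => x y; simpc.
Qed.

Lemma antilinear_Re_eq0 (W : set H) : (forall v, W v -> W ('i%C *: v)) ->
  (forall v, W v -> complex.Re (l v) = 0) -> forall v, W v -> l v = 0.
Proof.
move=> Wi l0 v Wv; apply/eqP; rewrite eq_complex /= antilinear_Im.
by rewrite !l0 ?eqxx //; exact: Wi.
Qed.

End Antilinear.

Lemma antilinear_bounded l : dual l ->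
  exists2 N : R, 0 <= N & forall v : H, rnorm (l v) <= N * rnorm v.
Proof.
move=> [hl lc]; have := lc 0.
move=> /cvgrPdist_lt/(_ 1 ltr01); rewrite nearE => /nbhs_ballP[d /= d0 dl].
have dE : d = (complex.Re d)%:C by rewrite RRe_real // gtr0_real.
move: d0 dl; rewrite {}dE; move: (complex.Re d) => {}d; rewrite ltcR => d0 dl.
exists (2 / d) => [|v]; first by rewrite divr_ge0 // ltW.
have [v0|v0] := eqVneq (rnorm v) 0.
  by rewrite v0 (rnorm0_eq0 v0) antilinear0 // mulr0 /rnorm normr0.
have {}v0 : 0 < rnorm v by rewrite lt0r v0 rnorm_ge0.
(* Rescaling [v] to norm [d / 2] puts it in the ball of radius [d], which [l] maps into the unit
   ball. *)
have t0 : 0 < d / 2 / rnorm v by rewrite !divr_gt0.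
have := dl ((d / 2 / rnorm v)%:C *: v); rewrite -ball_normE /= sub0r normrN.
rewrite normE ltcR rnormZ (ger0_norm (ltW t0)) divfK ?gt_eqF //.
rewrite ltr_pdivrMr // ltr_pMr // ltr1n => /(_ isT).
rewrite antilinear0 // sub0r normrN antilinear_Zreal // normrM normc_real.
rewrite (ger0_norm (ltW t0)) -[`|l v|]RRe_real ?normr_real // -rmorphM /= ltcR.
rewrite -/(rnorm (l v)) -ltr_pdivlMl // mulr1 => /ltW lv.
suff <- : (d / 2 / rnorm v)^-1 = 2 / d * rnorm v by [].
by field; rewrite !gt_eqF.
Qed.

Lemma dual_functional l : dual l ->
  bounded_functional (fun v : H => complex.Re (l v)).
Proof.
move=> dl; have [hl _] := dl; split; first exact: antilinear_rlinear.
have [N N0 lN] := antilinear_bounded dl; exists N => // v.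
exact: le_trans (Re_le_rnorm _) (lN v).
Qed.

Lemma dual_norm_bound l v : dual l -> rnorm (l v) <= @dual_norm _ H l * rnorm v.
Proof.
move=> dl; have [N N0 lN] := antilinear_bounded dl; have [hl _] := dl.
have [v0|v0] := eqVneq (rnorm v) 0.
  by rewrite v0 (rnorm0_eq0 v0) antilinear0 // mulr0 /rnorm normr0.
have {}v0 : 0 < rnorm v by rewrite lt0r v0 rnorm_ge0.
have v'1 : rnorm ((rnorm v)^-1%:C *: v) = 1.
  by rewrite rnormZ ger0_norm ?invr_ge0 ?rnorm_ge0 // mulVf ?gt_eqF.
rewrite -ler_pdivrMr //.
have -> : rnorm (l v) / rnorm v = rnorm (l ((rnorm v)^-1%:C *: v)).
  rewrite antilinear_Zreal // (rnormZ (X := R[i]^o)).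
  by rewrite ger0_norm ?invr_ge0 ?rnorm_ge0 // mulrC.
(* [sup] dominates the elements only of a set bounded above; continuity supplies the bound [N]. *)
apply: ub_le_sup; last by exists ((rnorm v)^-1%:C *: v) => //=; rewrite v'1.
by exists N => _ [u /= u1 <-]; rewrite (le_trans (lN u)) // ler_piMr.
Qed.

Lemma antilinear_dual l (N : R) : antilinear l -> 0 <= N ->
  (forall v : H, `|complex.Re (l v)| <= N * rnorm v) -> dual l.
Proof.
move=> hl N0 lN; split=> // u; apply/cvgrPdist_lt => e e0.
have eE : e = (complex.Re e)%:C by rewrite RRe_real // gtr0_real.
move: e0; rewrite {}eE; move: (complex.Re e) => {}e; rewrite ltcR => e0.
have N1 : 0 < 2 * N + 1 by rewrite ltr_wpDl // mulr_ge0.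
apply: filterS (nbhs_rnorm u (divr_gt0 e0 N1)) => v /=.
rewrite ltr_pdivlMr // => uv.
have -> : l u - l v = l (u - v).
  by apply/eqP; rewrite subr_eq -antilinearD // subrK.
rewrite -[`|_|]RRe_real ?normr_real // ltcR.
have := rnorm_le_ReIm (l (u - v)); rewrite antilinear_Im //.
have := lN (u - v); have := lN ('i%C *: (u - v)); rewrite rnorm_iZ.
have := rnorm_ge0 (u - v); rewrite -/(rnorm (l (u - v))); nra.
Qed.

Lemma dotp_dual w : dual (dotp H w).
Proof.
apply: (@antilinear_dual _ (rnorm w)); last 2 first.
- exact: rnorm_ge0.
- by move=> v; exact: rdot_cauchy_schwarz.
by move=> a u v; rewrite linearPr.
Qed.

(** Links weak compactness, which tests with [rdot], to the Mosco hypothesis, which tests with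
    complex functionals: real and imaginary parts are both bounded real functionals. *)
Lemma rdot_weakly_converges (x : nat -> H) w :
  (forall v, rdot (x m) v @[m --> \oo] --> rdot w v) -> weakly_converges x w.
Proof.
move=> xw l dl; have [hl _] := dl.
have Re_cvg := bounded_functional_weak_cvg xw (dual_functional dl).
have Im_fun : bounded_functional (fun v => complex.Im (l v)).
  have [[LD LZ] [N N0 LN]] := dual_functional dl.
  split; last by exists N => // v; rewrite antilinear_Im // -(rnorm_iZ v).
  split=> [u v|t u]; first by rewrite !antilinear_Im // scalerDr LD.
  by rewrite !antilinear_Im // scalerA mulrC -scalerA LZ.
have Im_cvg := bounded_functional_weak_cvg xw Im_fun.
apply/(rnorm_cvg (X := R[i]^o)).
apply: (@dominated_cvg0 _ _ (fun m => `|complex.Re (l (x m)) - complex.Re (l w)| +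
  `|complex.Im (l (x m)) - complex.Im (l w)|)).
  move=> m; rewrite ger0_norm ?rnorm_ge0 // -!raddfB; exact: rnorm_le_ReIm.
rewrite -[X in _ --> X](addr0 0); apply: cvgD; apply/norm_cvg0P/subr_cvg0 => //.
Qed.

End DualPairing.

(** * Unitary realisations *)

Lemma kernel_closed_rsubspace (R : realType) (H : hilbert R) (I : Type)
  (S : set I) (L_ : I -> H -> R) : (forall i, bounded_functional (L_ i)) ->
  closed_rsubspace [set u | forall i, S i -> L_ i u = 0].
Proof.
move=> hL; split => /=.
- by move=> i _; rewrite rlinear0 //; case: (hL i).
- by move=> u v u0 v0 i Si; have [[-> _] _] := hL i; rewrite u0 // v0 // addr0.
- by move=> t u u0 i Si; have [[_ ->] _] := hL i; rewrite u0 // mulr0.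
- move=> u_ u u0 uu i Si; have := bounded_functional_cvg (hL i) uu.
  move=> /(cvg_unique _); apply => //=.
  by under eq_fun do rewrite u0 //; exact: cvg_cst.
Qed.

Section Realisation.
Variables (R : realType) (H Hs : hilbert R) (pairing : Hs -> H -> R[i]).
Hypothesis hpairing : unitary_realisation pairing.

Lemma pairing_dual f : dual (pairing f).
Proof. by have [_ [pd _ _] _] := hpairing; exact: pd. Qed.

Lemma pairing_antilinear f : antilinear (pairing f).
Proof. by have [] := pairing_dual f. Qed.

Lemma pairingD f g v : pairing (f + g) v = pairing f v + pairing g v.
Proof. by have [pl _ _] := hpairing; rewrite -[f]scale1r pl mul1r scale1r. Qed.

Lemma pairing0 v : pairing 0 v = 0.
Proof.
by have := pairingD 0 0 v; rewrite addr0 => /eqP;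
  rewrite -subr_eq0 opprD addrA subrr sub0r oppr_eq0 => /eqP.
Qed.

Lemma pairingZ a f v : pairing (a *: f) v = a * pairing f v.
Proof. by have [pl _ _] := hpairing; rewrite -[a *: f]addr0 pl pairing0 addr0. Qed.

Lemma pairingB f g v : pairing (f - g) v = pairing f v - pairing g v.
Proof. by rewrite -scaleN1r pairingD pairingZ mulN1r. Qed.

Lemma pairing_Re_bound f v : `|complex.Re (pairing f v)| <= rnorm f * rnorm v.
Proof.
have [_ _ pn] := hpairing; rewrite -pn (le_trans (Re_le_rnorm _)) //.
exact: dual_norm_bound (pairing_dual f).
Qed.

Lemma pairing_functionall v : bounded_functional (fun f => complex.Re (pairing f v)).
Proof.
split; last first.
  by exists (rnorm v) => [|f]; [exact: rnorm_ge0|rewrite mulrC pairing_Re_bound].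
split=> [f g|t f]; first by rewrite pairingD raddfD.
by rewrite pairingZ; case: (pairing f v) => x y; simpc.
Qed.

Lemma operator_bounded_form (A : {linear H -> Hs}) : bounded_operator A ->
  bounded_form (fun u v => complex.Re (pairing (A u) v)).
Proof.
move=> Ab; split=> [v|u|].
- by have [] := bounded_operator_functional Ab (pairing_functionall v).
- exact: antilinear_rlinear (pairing_antilinear (A u)).
- have [M AM] := Ab; exists `|M| => // u v.
  rewrite (le_trans (pairing_Re_bound _ _)) // ler_wpM2r ?rnorm_ge0 //.
  by rewrite (le_trans (AM u)) // ler_wpM2r ?rnorm_ge0 // ler_norm.
Qed.

(** Testing with [i v] recovers the imaginary part of the equation. *)
Lemma solvesE (A : {linear H -> Hs}) W f u : closed_subspace W ->
  solves pairing A W f u <-> W u /\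
    forall v, W v -> complex.Re (pairing (A u) v) = complex.Re (pairing f v).
Proof.
move=> hW; split=> -[Wu uf]; split=> // v Wv; first by rewrite uf.
apply/eqP; rewrite -subr_eq0 -pairingB; apply/eqP; move: v Wv.
apply: (antilinear_Re_eq0 (pairing_antilinear _)) => [v|v Wv].
  exact: closed_subspaceZ.
by rewrite pairingB raddfB /= uf // subrr.
Qed.

Section Annihilator.
Variable W : set H.
Hypothesis hW : closed_subspace W.

Lemma annihilator_rsubspace : closed_rsubspace (annihilator pairing W).
Proof.
have -> : annihilator pairing W =
    [set f | forall w, W w -> complex.Re (pairing f w) = 0].
  apply/seteqP; split=> f fW; first by move=> w Ww; rewrite fW.
  apply: (antilinear_Re_eq0 (pairing_antilinear f)) => // w.
  exact: closed_subspaceZ.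
exact: kernel_closed_rsubspace pairing_functionall.
Qed.

Lemma annihilator_i f : annihilator pairing W f -> annihilator pairing W ('i%C *: f).
Proof. by move=> fW w Ww; rewrite pairingZ fW // mulr0. Qed.

Lemma dual_realisation_i f :
  dual_realisation pairing W f -> dual_realisation pairing W ('i%C *: f).
Proof. by move=> fW g gW; rewrite linearZl_LR /= fW // mulr0. Qed.

Lemma dual_realisation_rsubspace : closed_rsubspace (dual_realisation pairing W).
Proof.
have -> : dual_realisation pairing W =
    [set f | forall g, annihilator pairing W g -> rdot f g = 0].
  apply/seteqP; split=> f fW; first by move=> g gW; rewrite /rdot fW.
  apply: (antilinear_Re_eq0 (dotp_dual f).1) => //; exact: annihilator_i.
apply: (@kernel_closed_rsubspace _ _ _ _ (fun g f => rdot f g)) => g.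
exact: form_functionall (rdot_bounded_form Hs).
Qed.

(** The part of [f] orthogonal to the annihilator lies in the dual realisation, so it is orthogonal
    to [f] and hence to itself. *)
Lemma dual_realisation_orthogonal f :
  orthogonal_complement (dual_realisation pairing W) f -> annihilator pairing W f.
Proof.
move=> fD; have [p Wp fp] := rdot_projection f annihilator_rsubspace.
have Dq : dual_realisation pairing W (f - p).
  by apply: (antilinear_Re_eq0 (dotp_dual _).1) => //; exact: annihilator_i.
suff /eqP : f - p = 0 by rewrite subr_eq0 => /eqP ->.
apply: rdot_nondegenerate; rewrite [LHS](formBl (rdot_bounded_form Hs)).
by rewrite (rdotC p) fp // {1}/rdot fD // subr0.
Qed.

Lemma dual_projectionP f :
  let p := orthogonal_projection (dual_realisation pairing W) f in
  dual_realisation pairing W p /\ annihilator pairing W (f - p).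
Proof.
move=> p; have [q Dq fq] := rdot_projection f dual_realisation_rsubspace.
have [Dp fp] : [set p | dual_realisation pairing W p /\
    orthogonal_complement (dual_realisation pairing W) (f - p)] p.
  (* The projection exists, so [xget] does not return its default. *)
  apply: xgetPex; exists q; split=> //.
  apply: (antilinear_Re_eq0 (dotp_dual _).1) => //; exact: dual_realisation_i.
by split=> //; exact: dual_realisation_orthogonal.
Qed.

Lemma dual_projection_pairing f v : W v ->
  pairing (orthogonal_projection (dual_realisation pairing W) f) v = pairing f v.
Proof.
move=> Wv; have [_ /(_ v Wv)] := dual_projectionP f.
by rewrite pairingB => /eqP; rewrite subr_eq0 => /eqP.
Qed.

Lemma dual_projection_eq0 f : annihilator pairing W f ->
  orthogonal_projection (dual_realisation pairing W) f = 0.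
Proof.
move=> fW; have [Dp _] := dual_projectionP f.
apply: rdot_nondegenerate; rewrite /rdot Dp // => w Ww.
by rewrite dual_projection_pairing // fW.
Qed.

Variable A : {linear H -> Hs}.
Hypothesis hA : invertible_on pairing A W.

Lemma invertible_on_solvable f : exists u, solves pairing A W f u.
Proof.
have [_ _ surj] := hA; have [Df _] := dual_projectionP f.
have [u Wu /= uf] := surj _ Df; exists u; split=> // v Wv.
by rewrite -(dual_projection_pairing (A u)) // uf dual_projection_pairing.
Qed.

Lemma invertible_on_injective w : W w ->
  (forall v, W v -> complex.Re (pairing (A w) v) = 0) -> w = 0.
Proof.
move=> Ww Aw; have [_ inj _] := hA; apply: inj.
- exact/mem_set.
- by apply/mem_set; case: (closed_subspace_rsubspace hW).
rewrite /= linear0 !dual_projection_eq0 //; first by move=> v _; exact: pairing0.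
apply: (antilinear_Re_eq0 (pairing_antilinear _)) => // v.
exact: closed_subspaceZ.
Qed.

(** Solvability gives injectivity of the transpose: solve with the datum representing [dotp H w] and
    test with [w], so that the squared norm of [w] vanishes. *)
Lemma invertible_on_transposed_injective w : W w ->
  (forall v, W v -> complex.Re (pairing (A v) w) = 0) -> w = 0.
Proof.
move=> Ww Aw; have [_ [_ _ surj] _] := hpairing.
have [f _ fw] := surj _ (dotp_dual w).
have [u [Wu uf]] := invertible_on_solvable f.
by apply: rdot_nondegenerate; rewrite /rdot -fw -uf // Aw.
Qed.

End Annihilator.
End Realisation.

(** * Convergence *)

Lemma lipschitz_continuous (R : realType) (X Y : normedModType R[i])
  (S : X -> Y) (C : R) : 0 < C ->
  (forall f g, rnorm (S f - S g) <= C * rnorm (f - g)) -> continuous S.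
Proof.
move=> C0 SC f; apply/cvgrPdist_lt => e e0.
have eE : e = (complex.Re e)%:C by rewrite RRe_real // gtr0_real.
move: e0; rewrite {}eE; move: (complex.Re e) => {}e; rewrite ltcR => e0.
apply: filterS (nbhs_rnorm f (divr_gt0 e0 C0)) => g /=.
rewrite ltr_pdivlMr // mulrC => fg.
by rewrite normE ltcR (le_lt_trans (SC f g)).
Qed.

(** Half of [e] is spent on replacing [v] by some [w] in [Wt], the other half on a near-minimiser
    [v'] for [w]. *)
Lemma asymptotically_dense_closure (R : realType) (H : hilbert R)
  (V Wt : set H) (Vh_ : nat -> set H) :
  (forall j, closed_subspace (Vh_ j)) -> V `<=` closure Wt ->
  (forall w, Wt w ->
     inf [set rnorm (w - v) | v in Vh_ j] @[j --> \oo] --> (0 : R)) ->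
  asymptotically_dense V Vh_.
Proof.
move=> hVh VWt Wt_inf v Vv e e0; have e2 : 0 < e / 2 by rewrite divr_gt0.
have [w [Ww /= vw]] := VWt v Vv _ (nbhs_rnorm v e2).
have /cvgrPdist_lt/(_ _ e2)[J _ JP] := Wt_inf w Ww.
exists J => j Jj; have := JP j Jj; rewrite /= sub0r normrN => /ltr_normlW.
set E := [set _ | _ in _] => infE.
have E0 : has_inf E.
  split; last by exists 0 => _ [x _ <-]; exact: rnorm_ge0.
  exists (rnorm (w - 0)), 0 => //.
  by case: (closed_subspace_rsubspace (hVh j)).
have gap : 0 < e / 2 - inf E by rewrite subr_gt0.
have [_ [v' jv' <-] wv'] := inf_adherent gap E0.
exists v' => //; have -> : v - v' = (v - w) + (w - v') by rewrite addrA subrK.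
rewrite (le_lt_trans (rnormD _ _)) //; move: wv'; lra.
Qed.

(** * The Garding inequality *)

Section Garding.
Variables (R : realType) (H Hs : hilbert R) (pairing : Hs -> H -> R[i]).
Hypothesis hpairing : unitary_realisation pairing.

(** Coercivity bounds a complex modulus, hence the second term, the imaginary part of
    [pairing (A u) u]. The compact part is subtracted in both terms, hence the factor 2. *)
Lemma compactly_perturbed_coercive_garding (A : {linear H -> Hs}) :
  compactly_perturbed_coercive pairing A ->
  exists (K : {linear H -> Hs}) (alpha : R),
    [/\ bounded_operator K, compact_operator K, 0 < alpha &
      forall u, alpha * rnorm u ^+ 2 <= `|complex.Re (pairing (A u) u)| +
        `|complex.Re (pairing (A u) ('i%C *: u))| + 2 * rnorm (K u) * rnorm u].
Proof.
move=> [[M AM] [A0 [A1 [[[M0 A0M] [alpha alpha0 coer]] A1c AE]]]].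
exists A1, alpha; split=> //.
  exists (M + M0) => u; have -> : A1 u = A u - A0 u by rewrite AE addrC addKr.
  by rewrite (le_trans (rnormD _ _)) // rnormN mulrDl lerD.
have A0E u v : complex.Re (pairing (A0 u) v) =
    complex.Re (pairing (A u) v) - complex.Re (pairing (A1 u) v).
  by rewrite AE (pairingD hpairing) raddfD addrK.
move=> u; rewrite (le_trans (coer u)) // (le_trans (rnorm_le_ReIm _)) //.
rewrite (antilinear_Im (pairing_antilinear hpairing _)) !A0E.
have := pairing_Re_bound hpairing (A1 u) u.
have := pairing_Re_bound hpairing (A1 u) ('i%C *: u); rewrite rnorm_iZ.
have := ler_normB (complex.Re (pairing (A u) u)) (complex.Re (pairing (A1 u) u)).
have := ler_normB (complex.Re (pairing (A u) ('i%C *: u)))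
  (complex.Re (pairing (A1 u) ('i%C *: u))).
lra.
Qed.

(** Lets the same Garding inequality serve the transposed form. *)
Lemma pairing_swap_i (A : {linear H -> Hs}) u :
  `|complex.Re (pairing (A ('i%C *: u)) u)| =
  `|complex.Re (pairing (A u) ('i%C *: u))|.
Proof.
rewrite -(antilinear_Im (pairing_antilinear hpairing _)).
rewrite linearZ (pairingZ hpairing); case: (pairing (A u) u) => x y /=.
by rewrite mul0r mul1r sub0r normrN.
Qed.

End Garding.

Theorem theorem4p1 (R : realType) (H Hs : hilbert R) (pairing : Hs -> H -> R[i])
  (hpairing : unitary_realisation pairing)
  (V : set H) (V_ Vh_ : nat -> set H)
  (hV : closed_subspace V)
  (hV_ : forall j, closed_subspace (V_ j))
  (hVh_ : forall j, closed_subspace (Vh_ j))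
  (hVhV : forall j, Vh_ j `<=` V_ j)
  (A : {linear H -> Hs})
  (hA : compactly_perturbed_coercive pairing A)
  (hAV : invertible_on pairing A V)
  (hmosco : mosco_converges V_ V)
  (hdense : exists Wt : set H,
    [/\ submod_closed [in Wt], Wt `<=` V, V `<=` closure Wt &
        forall w, Wt w ->
          inf [set rnorm (w - v) | v in Vh_ j] @[j --> \oo] --> (0 : R)]) :
  exists J : nat,
    (forall j, (J <= j)%N -> well_posed (solves pairing A (Vh_ j))) /\
    (forall f : Hs, exists u : H,
      unique (solves pairing A V f) u /\
      forall uh : nat -> H,
        (forall j, (J <= j)%N -> solves pairing A (Vh_ j) f (uh j)) ->
        rnorm (uh j - u) @[j --> \oo] --> (0 : R)).
Proof.
have Vh_weak : weak_limits_in V Vh_.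
  move=> phi x w phi_incr xV /rdot_weakly_converges.
  by apply: hmosco.2 phi_incr _ => m; exact: hVhV (xV m).
have Vh_dense : asymptotically_dense V Vh_.
  have [Wt [_ _ VWt Wt_inf]] := hdense.
  exact: asymptotically_dense_closure VWt Wt_inf.
have Ab : bounded_operator A by case: hA.
have hb := operator_bounded_form hpairing Ab.
pose b u v := complex.Re (pairing (A u) v); rewrite -/b in hb.
have [K [alpha [Kb Kc alpha0 garding]]] :=
  compactly_perturbed_coercive_garding hpairing hA.
have [beta beta0 [J1 inf_sup]] := uniform_inf_sup hVh_ Vh_weak Vh_dense hb Kb Kc
  alpha0 garding (invertible_on_injective hpairing hV hAV).
have garding' u : alpha * rnorm u ^+ 2 <=
    `|b u u| + `|b ('i%C *: u) u| + 2 * rnorm (K u) * rnorm u.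
  by rewrite /b pairing_swap_i.
have [beta' beta'0 [J2 inf_sup']] := uniform_inf_sup hVh_ Vh_weak Vh_dense
  (form_swap hb) Kb Kc alpha0 garding'
  (invertible_on_transposed_injective hpairing hV hAV).
(* Gives uniqueness with [C = 0] and the Lipschitz constant [beta^-1] of the solution map; existence
   rests on the transposed condition. *)
have stability j u v f g (C : R) : (J1 <= j)%N -> 0 <= C ->
    solves pairing A (Vh_ j) f u -> solves pairing A (Vh_ j) g v ->
    rnorm (f - g) <= C -> beta * rnorm (u - v) <= C.
  move=> Jj C0 [ju uf] [jv vg] fg.
  apply: (inf_sup j) => // [|x jx]; first exact: closed_subspaceB.
  rewrite (formBl hb) /b uf // vg // -raddfB -(pairingB hpairing).
  by rewrite (le_trans (pairing_Re_bound hpairing _ _)) // ler_wpM2r ?rnorm_ge0.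
have existence j f : (J2 <= j)%N -> exists u, solves pairing A (Vh_ j) f u.
  move=> Jj; have jh := closed_subspace_rsubspace (hVh_ j).
  have [u ju uf] := inf_sup_solvable jh hb beta'0 (inf_sup' j Jj)
    (dual_functional (pairing_dual hpairing f)).
  by exists u; apply/(solvesE hpairing).
exists (maxn J1 J2); split=> [j|f].
  rewrite geq_max => /andP[J1j J2j].
  have /choice[S SP] f : exists u, solves pairing A (Vh_ j) f u by exact: existence.
  exists S => [|f u].
    apply: (@lipschitz_continuous _ _ _ S beta^-1); first by rewrite invr_gt0.
    move=> f g; rewrite ler_pdivlMl //.
    exact: stability _ _ _ _ _ _ J1j (rnorm_ge0 _) (SP f) (SP g) (lexx _).
  split=> [fu|->//]; apply/eqP; rewrite -subr_eq0; apply/eqP/rnorm0_eq0.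
  have := stability j _ _ _ _ 0 J1j (lexx _) fu (SP f).
  rewrite subrr rnorm0 lexx => /(_ isT); rewrite pmulr_rle0 // => uS.
  by apply/eqP; rewrite eq_le uS rnorm_ge0.
have [u [Vu uf]] := invertible_on_solvable hpairing hV hAV f.
exists u; split.
  split=> // v [Vv vf]; apply/eqP; rewrite -subr_eq0; apply/eqP.
  apply: (invertible_on_injective hpairing hV hAV) => [|x Vx].
    exact: closed_subspaceB.
  by rewrite linearB (pairingB hpairing) uf // vf // subrr.
move=> uh uhP.
(* The residual of [u] vanishes on [V] and is the consistency error on [Vh_ j]. *)
pose L v := complex.Re (pairing (f - A u) v).
have LV v : V v -> L v = 0.
  by move=> Vv; rewrite /L (pairingB hpairing) uf // subrr.
have hL : bounded_functional L := dual_functional (pairing_dual hpairing _).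
have [_ _ [M M0 bM]] := hb.
apply/cvgr0Pnorm_lt => e e0.
have c0 : 0 < (1 + M) / beta + 1.
  by rewrite ltr_wpDl // divr_ge0 ?addr_ge0 // ltW.
(* Chosen so that the discrete error [(1 + M) / beta * d] and the approximation error, below [d],
   add up to less than [e]. *)
pose d := e / ((1 + M) / beta + 1); have d0 : 0 < d by rewrite divr_gt0.
have [J3 consistency] := annihilating_functional_small hVh_ Vh_weak hL LV d0.
have [J4 approx] := Vh_dense u Vu d d0.
near=> j.
have Jj : (maxn J1 J2 <= j)%N by near: j; exact: nbhs_infty_ge.
have J3j : (J3 <= j)%N by near: j; exact: nbhs_infty_ge.
have J4j : (J4 <= j)%N by near: j; exact: nbhs_infty_ge.
have [v jv uv] := approx j J4j; have [juh uhf] := uhP j Jj.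
have : beta * rnorm (uh j - v) <= (1 + M) * d.
  apply: (inf_sup j) => [|||x jx]; first by rewrite (leq_trans _ Jj) ?leq_maxl.
  - exact: closed_subspaceB.
  - by rewrite mulr_ge0 ?addr_ge0 // ltW.
  (* The consistency term contributes [d] and the approximation term [M * d] to the inf-sup
     bound. *)
  have -> : b (uh j - v) x = L x + b (u - v) x.
    by rewrite !(formBl hb) /b uhf // /L (pairingB hpairing) raddfB addrA subrK.
  rewrite (le_trans (ler_normD _ _)) // -mulrA mulrDl mul1r.
  apply: lerD; first exact: consistency J3j _ jx.
  rewrite (le_trans (bM _ _)) // -mulrA ler_wpM2l // ler_wpM2r ?rnorm_ge0 //.
  exact: ltW.
rewrite ger0_norm ?rnorm_ge0 // mulrC -ler_pdivlMr // mulrAC => uhv.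
have -> : uh j - u = (uh j - v) + (v - u) by rewrite addrA subrK.
rewrite (le_lt_trans (rnormD _ _)) // [rnorm (v - u)]rnormB.
have -> : e = (1 + M) / beta * d + d.
  by rewrite -{2}[d]mul1r -mulrDl mulrC divfK ?gt_eqF.
by rewrite ler_ltD.
Unshelve. all: by end_near. Qed.
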